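(* Let $X\subset\mathbb{R}^2$ be an open convex set and let $f:X\to\mathbb{R}$ be a convex function. For each $x\in X$, $\Delta^{\oplus}f(x)\in\partial f(x)$.
   Context: $f'(x;d):=\lim_{t\downarrow 0}\frac{f(x+td)-f(x)}{t}$ denotes the one-sided directional derivative (it exists in $\mathbb{R}$ for every $d$ when $f$ is convex on an open convex set). The compass difference of $f:X\subset\mathbb{R}^2\to\mathbb{R}$ at $x$ is the vector $$\Delta^{\oplus}f(x):=\frac12\begin{bmatrix} f'(x;(1,0))-f'(x;(-1,0))\\ f'(x;(0,1))-f'(x;(0,-1))\end{bmatrix}\in\mathbb{R}^2.$$ $\partial f(x)$ is the convex subdifferential: the set of $s\in\mathbb{R}^2$ with $f(y)\ge f(x)+\langle s,y-x\rangle$ for all $y\in X$, where $\langle\cdot,\cdot\rangle$ is the Euclidean inner product. *)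

(* Defs.v *)
From HB Require Import structures.
From mathcomp Require Import all_boot all_order all_algebra.
From mathcomp Require Import all_classical all_reals all_analysis.

Set Implicit Arguments.
Unset Strict Implicit.
Unset Printing Implicit Defensive.

Import Order.TTheory GRing.Theory Num.Theory.
Import numFieldNormedType.Exports.

Local Open Scope classical_set_scope.
Local Open Scope ring_scope.

(* A function on a subset X of R^2 is represented by a total function on
   'rV[R]_2 of which only the values on X matter: for x in an open X, the limit
   below depends only on the values of f on X. *)

Definition dir_deriv (R : realType) (f : 'rV[R]_2 -> R) (x d : 'rV[R]_2) : R :=
  lim ((f (x + t *: d) - f x) / t @[t --> 0^'+]).

Definition compass_difference (R : realType) (f : 'rV[R]_2 -> R)
    (x : 'rV[R]_2) : 'rV[R]_2 :=
  \row_(i < 2) (2^-1 * (dir_deriv f x (delta_mx 0 i)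
                        - dir_deriv f x (- delta_mx 0 i))).

Definition dotv (R : realType) (u v : 'rV[R]_2) : R :=
  \sum_(i < 2) u 0 i * v 0 i.

Definition subdifferential (R : realType) (X : set 'rV[R]_2)
    (f : 'rV[R]_2 -> R) (x : 'rV[R]_2) : set 'rV[R]_2 :=
  [set s | forall y, X y -> f y >= f x + dotv s (y - x)].

(* Main.v *)
(* Write p d = f'(x; d). By convexity p exists and is sublinear, and
   p (y - x) <= f y - f x. For d = d1 + d2 with d1, d2 along the two axes,
   subadditivity gives p d2 <= p d + p (- d1) and p d1 <= p d + p (- d2);
   averaging, p d >= ((p d1 - p (- d1)) + (p d2 - p (- d2))) / 2, and the right
   side is the inner product of the compass difference with d because
   d |-> p d - p (- d) is homogeneous of degree one for scalars of any sign. *)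
Require Import Defs.
From HB Require Import structures.
From mathcomp Require Import all_boot all_order all_algebra.
From mathcomp Require Import all_classical all_reals all_analysis.
From mathcomp Require Import lra.

Set Implicit Arguments.
Unset Strict Implicit.
Unset Printing Implicit Defensive.

Import Order.TTheory GRing.Theory Num.Theory.
Import numFieldNormedType.Exports.

Local Open Scope classical_set_scope.
Local Open Scope ring_scope.

Section directional_derivative.
Context (R : realType).
Let V := 'rV[R]_2.
Implicit Types (X : set V) (f : V -> R) (x y d u v : V) (a s t : R).

Definition dir_slope f x d t : R := (f (x + t *: d) - f x) / t.

(** Justifies the substitution of [a * t] for [t] in a one-sided limit, used for homogeneity and,
    with [a = 2], for subadditivity. *)
Lemma at_right_scale a : 0 < a -> a * t @[t --> 0^'+] --> 0^'+.
Proof.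
move=> a0 P [e /= e0 eP]; exists (e / a); first exact: divr_gt0.
move=> t /=; rewrite sub0r normrN => te t0; apply: eP => /=; last first.
  exact: mulr_gt0.
by rewrite sub0r normrN normrM gtr0_norm// mulrC -ltr_pdivlMr.
Qed.

Lemma near_line X x d : open X -> X x -> \forall t \near 0, X (x + t *: d).
Proof.
move=> oX Xx; have cx : x + t *: d @[t --> (0 : R)] --> x.
  rewrite -[X in _ --> X]addr0 -(scale0r d).
  by apply: cvgD; [exact: cvg_cst | apply: cvgZr_tmp; exact: cvg_id].
by apply: cx; exact: open_nbhs_nbhs.
Qed.

Lemma near_right_line X x d : open X -> X x ->
  \forall t \near 0^'+, X (x + t *: d).
Proof. by move=> oX Xx; apply: cvg_within; exact: near_line. Qed.

Lemma convex_function_le X f x y s t : @convex_function R V X f ->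
  X x -> X y -> 0 <= s -> 0 <= t -> s + t = 1 ->
  f (s *: x + t *: y) <= s * f x + t * f y.
Proof.
move=> cf Xx Xy s0 t0 st1; have s01 : 0 <= s <= 1 by lra.
have -> : t = 1 - s by lra.
exact: (cf (Itv01 s0 (proj2 (andP s01))) x y (mem_set Xx) (mem_set Xy)).
Qed.

Section at_point.
Context X f x (oX : open X) (cf : @convex_function R V X f) (Xx : X x).

(** The point [x + s *: d] is the convex combination of [x + t *: d] and [x] with weights [s / t]
    and [1 - s / t]. *)
Let convex_function_scale_le d s t : 0 < s -> s <= t -> X (x + t *: d) ->
  f (x + s *: d) <= f x + s / t * (f (x + t *: d) - f x).
Proof.
move=> s0 st Xt; have t0 : 0 < t by exact: lt_le_trans st.
have r0 : 0 <= s / t by rewrite divr_ge0// ltW.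
have r1 : 0 <= 1 - s / t by rewrite subr_ge0 ler_pdivrMr// mul1r.
have := convex_function_le cf Xt Xx r0 r1 (subrKC _ _).
rewrite (_ : _ *: _ + _ = x + s *: d).
  by move=> /le_trans; apply; lra.
rewrite scalerDr scalerA divfK ?gt_eqF// scalerBl scale1r.
by rewrite addrAC addrCA subrr addr0.
Qed.

Lemma dir_slope_le d s t : 0 < s -> s <= t -> X (x + t *: d) ->
  dir_slope f x d s <= dir_slope f x d t.
Proof.
move=> s0 st Xt; rewrite /dir_slope ler_pdivrMr// lerBlDl.
by rewrite mulrAC -mulrA mulrC; exact: convex_function_scale_le.
Qed.

(** Here [x] itself is the convex combination of [x + t *: d] and [x - s *: d] with weights
    [s / (s + t)] and [t / (s + t)]. This bounds the forward slopes from below. *)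
Lemma dir_slopeN_le d s t : 0 < s -> 0 < t ->
  X (x + s *: - d) -> X (x + t *: d) ->
  - dir_slope f x (- d) s <= dir_slope f x d t.
Proof.
move=> s0 t0 Xs Xt; have st0 : 0 < s + t by exact: addr_gt0.
have s1 : 0 <= s / (s + t) by rewrite divr_ge0// ltW.
have t1 : 0 <= t / (s + t) by rewrite divr_ge0// ltW.
have st1 : s / (s + t) + t / (s + t) = 1 by rewrite -mulrDl divff ?gt_eqF.
have := convex_function_le cf Xt Xs s1 t1 st1.
rewrite (_ : _ *: _ + _ = x); last first.
  rewrite !scalerDr addrACA -scalerDl -mulrDl divff ?gt_eqF// scale1r.
  rewrite !scalerN !scalerA mulrAC [t / _ * s]mulrAC [t * s]mulrC.
  by rewrite subrr addr0.
rewrite mulrAC [t / _ * _]mulrAC -mulrDl ler_pdivlMr// => le.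
rewrite /dir_slope -mulNr ler_pdivrMr// mulrAC ler_pdivlMr//.
lra.
Qed.

(** The slopes are nondecreasing in [t] and bounded below near 0, so the [lim] in [dir_deriv] is a
    genuine limit and not a default value. *)
Lemma cvg_dir_slope d : dir_slope f x d @ 0^'+ --> dir_deriv f x d.
Proof.
(* One fixed backward point suffices: its slope gives a lower bound uniform in [t]. *)
have [s s0 Xs] : exists2 s, 0 < s & X (x + s *: - d).
  near (0 : R)^'+ => s; exists s; first by near: s; exact: nbhs_right_gt.
  by near: s; exact: near_right_line.
have [e /= e0 eX] : \forall t \near 0^'+, X (x + t *: d).
  exact: near_right_line.
have {}eX t : 0 < t -> t < e -> X (x + t *: d).
  by move=> t0 te; apply: eX => //=; rewrite sub0r normrN gtr0_norm.
apply: nondecreasing_at_right_is_cvgr; near=> r.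
  move=> t u; rewrite !in_itv /= => /andP[t0 tr] /andP[u0 ur] tu.
  apply: dir_slope_le => //; apply: eX => //; apply: lt_le_trans ur _.
  by near: r; exact: nbhs_right_le.
exists (- dir_slope f x (- d) s) => _ [t /= + <-].
rewrite in_itv /= => /andP[t0 tr]; apply: dir_slopeN_le => //.
apply: eX => //; apply: lt_le_trans tr _.
by near: r; exact: nbhs_right_le.
Unshelve. all: by end_near. Qed.

(** The increment [f y - f x] is the slope at [t = 1], which dominates the slopes at smaller [t] and
    hence their limit. *)
Lemma dir_deriv_le y : X y -> dir_deriv f x (y - x) <= f y - f x.
Proof.
move=> Xy; apply: limr_le; first exact: cvg_dir_slope.
near=> t; have t0 : 0 < t by [].
have -> : f y - f x = dir_slope f x (y - x) 1.
  by rewrite /dir_slope scale1r addrCA subrr addr0 divr1.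
apply: dir_slope_le => //; last by rewrite scale1r addrCA subrr addr0.
by near: t; exact: nbhs_right_le.
Unshelve. all: by end_near. Qed.

Lemma cvg_dir_slopeM a d : 0 < a ->
  dir_slope f x d (a * t) @[t --> 0^'+] --> dir_deriv f x d.
Proof.
move=> a0; apply: (@cvg_comp _ _ _ ( *%R a)); last exact: cvg_dir_slope.
exact: at_right_scale.
Qed.

Lemma dir_derivZ a d : 0 <= a -> dir_deriv f x (a *: d) = a * dir_deriv f x d.
Proof.
rewrite le_eqVlt => /predU1P[<-|a0].
  (* For [a = 0] the substitution degenerates, but every slope is then zero. *)
  rewrite mul0r scale0r; apply: cvg_lim => //.
  under eq_fun do rewrite scaler0 addr0 subrr mul0r.
  exact: cvg_cst.
apply: cvg_lim => //.
(* The slope along [a *: d] at [t] is [a] times the slope along [d] at [a * t]. *)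
under eq_fun => t.
  rewrite (_ : _ / t = a * dir_slope f x d (a * t)); first over.
  rewrite /dir_slope invfM scalerA [t * a]mulrC.
  by rewrite [RHS]mulrCA mulVKf ?gt_eqF.
by apply: cvgM; [exact: cvg_cst | exact: cvg_dir_slopeM].
Qed.

(** The point [x + t *: (u + v)] is the midpoint of [x + (2 * t) *: u] and [x + (2 * t) *: v].
    Convexity there compares slopes at [t] with slopes at [2 * t], and the limit removes the factor
    2. *)
Lemma dir_derivD u v :
  dir_deriv f x (u + v) <= dir_deriv f x u + dir_deriv f x v.
Proof.
have near2 w : \forall t \near 0^'+, X (x + (2 * t) *: w).
  by have /(_ _ (near_right_line w oX Xx)) := @at_right_scale 2 (ltr0n _ 2).
have c2 w := @cvg_dir_slopeM 2 w (ltr0n _ 2).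
have c : dir_slope f x u (2 * t) + dir_slope f x v (2 * t) @[t --> 0^'+] -->
  dir_deriv f x u + dir_deriv f x v by exact: cvgD (c2 u) (c2 v).
rewrite -(cvg_lim _ c)//; apply: ler_lim.
- exact: (@cvg_dir_slope (u + v)).
- exact: (cvgP _ c).
near=> t; have t0 : 0 < t by [].
have Xu : X (x + (2 * t) *: u).
  by near: t; exact: near2.
have Xv : X (x + (2 * t) *: v).
  by near: t; exact: near2.
have h0 : 0 <= 2^-1 :> R by rewrite invr_ge0.
have h1 : 2^-1 + 2^-1 = 1 :> R by lra.
have := convex_function_le cf Xu Xv h0 h0 h1.
rewrite (_ : _ *: _ + _ = x + t *: (u + v)); last first.
  rewrite !scalerDr addrACA -scalerDl h1 scale1r !scalerA.
  by rewrite mulKf ?pnatr_eq0.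
move=> le; rewrite /dir_slope invfM !mulrA -mulrDl ler_pM2r ?invr_gt0//.
by lra.
Unshelve. all: by end_near. Qed.

Lemma dir_deriv_oddZ a d :
  dir_deriv f x (a *: d) - dir_deriv f x (- (a *: d)) =
  a * (dir_deriv f x d - dir_deriv f x (- d)).
Proof.
have [a0|/ltW a0] := leP 0 a; first by rewrite -scalerN !dir_derivZ// mulrBr.
(* For negative [a], write [a *: d] as [(- a) *: (- d)]: the two derivatives trade places, which
   restores the sign. *)
have na0 : 0 <= - a by rewrite oppr_ge0.
by rewrite -scaleNr -[a *: d]opprK -scaleNr -scalerN !dir_derivZ//; lra.
Qed.

(* Add the two subadditivity bounds v = (u + v) - u and u = (u + v) - v. *)
Lemma dir_deriv_odd_le u v :
  dir_deriv f x u - dir_deriv f x (- u) + (dir_deriv f x v - dir_deriv f x (- v))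
  <= 2 * dir_deriv f x (u + v).
Proof.
have := dir_derivD (u + v) (- u); have := dir_derivD (u + v) (- v).
by rewrite addrK addrAC subrr add0r; lra.
Qed.

(** With [u], [v] the coordinate vectors and [a], [b] the coordinates of a displacement, the left
    side is its inner product with the compass difference. *)
Lemma dir_deriv_oddZ_le a b u v :
  2^-1 * (dir_deriv f x u - dir_deriv f x (- u)) * a
  + 2^-1 * (dir_deriv f x v - dir_deriv f x (- v)) * b
  <= dir_deriv f x (a *: u + b *: v).
Proof.
have := dir_deriv_odd_le (a *: u) (b *: v).
rewrite (dir_deriv_oddZ a u) (dir_deriv_oddZ b v).
move: (dir_deriv f x u - _) (dir_deriv f x v - _).
by move: (dir_deriv f x (a *: u + b *: v)) => *; lra.
Qed.

End at_point.
End directional_derivative.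

Theorem corollary3p6 (R : realType) (X : set 'rV[R]_2) (f : 'rV[R]_2 -> R)
    (openX : open X) (convexX : @convex_set R 'rV[R]_2 X)
    (convexf : @convex_function R 'rV[R]_2 X f)
    (x : 'rV[R]_2) (Xx : X x) :
  subdifferential X f x (compass_difference f x).
Proof.
move=> y Xy /=; rewrite -lerBrDl.
apply: le_trans (dir_deriv_le openX convexf Xx Xy).
move: (y - x) => d.
have i1 : lift ord0 ord0 = 1 :> 'I_2 by exact/val_inj.
have dE : d = d 0 0 *: delta_mx 0 0 + d 0 1 *: delta_mx 0 1.
  by rewrite [LHS]matrix_sum_delta big_ord1 big_ord_recl big_ord1 i1.
rewrite [in leRHS]dE.
rewrite /dotv big_ord_recl big_ord1 i1 !mxE.
exact: (dir_deriv_oddZ_le openX convexf Xx).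
Qed.
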